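(* The chromatic number of $\mathbb{H}'_{\mathbb{N}^{\mathbb{N}}}$ is $\mathfrak{d}$.
   Context: Working in $\mathsf{ZFC}$. For $t\in\mathbb{N}^{<\mathbb{N}}$ (finite sequences of naturals), $\mathcal{N}_t=\{b\in\mathbb{N}^{\mathbb{N}} : t\sqsubseteq b\}$, and $t\cdot(k)$ is $t$ followed by the single entry $k$. $\mathbb{H}'_{\mathbb{N}^{\mathbb{N}}}$ is the $\mathbb{N}$-dimensional dihypergraph on $\mathbb{N}^{\mathbb{N}}$ given by $\mathbb{H}'_{\mathbb{N}^{\mathbb{N}}}=\bigcup_{(e,t)}\prod_{n\in\mathbb{N}}\mathcal{N}_{t\cdot(e(n))}$, where $(e,t)$ ranges over all pairs of an injective function $e\colon\mathbb{N}\to\mathbb{N}$ and $t\in\mathbb{N}^{<\mathbb{N}}$. (An $\mathbb{N}$-dimensional dihypergraph on $X$ is a set of non-constant sequences in $X^{\mathbb{N}}$.) The chromatic number of a dihypergraph $H$ on $X$ is the least cardinal $\kappa$ for which there is a map from $X$ to a set of cardinality $\kappa$ that is non-constant along every element of $H$. $\mathfrak{d}$ is the dominating number: the least cardinality of a set $\mathcal{F}\subseteq\mathbb{N}^{\mathbb{N}}$ such that for every $c\in\mathbb{N}^{\mathbb{N}}$ there is $d\in\mathcal{F}$ with $c(n)\le d(n)$ for all but finitely many $n$. *)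

(* Defs.v *)
From mathcomp Require Import all_boot.
From mathcomp Require Import boolp classical_sets functions cardinality.

Set Implicit Arguments.
Unset Strict Implicit.
Unset Printing Implicit Defensive.

Local Open Scope classical_set_scope.
Local Open Scope card_scope.

Definition nonconstant (T : Type) (x : nat -> T) : Prop :=
  exists i j, x i <> x j.

Record dihypergraph (X : Type) := Dihypergraph {
  edges : set (nat -> X);
  edges_nonconstant : forall x, edges x -> nonconstant x
}.

Definition cylinder (t : seq nat) : set (nat -> nat) :=
  [set b | forall i, (i < size t)%N -> b i = nth 0 t i].

Definition H'_edges : set (nat -> (nat -> nat)) :=
  \bigcup_(et in [set et : (nat -> nat) * seq nat | injective et.1])
    [set x | forall n, cylinder (rcons et.2 (et.1 n)) (x n)].

Lemma H'_edges_nonconstant (x : nat -> (nat -> nat)) :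
  H'_edges x -> nonconstant x.
Proof.
case=> -[e t] /= einj xP; exists 0, 1 => /(congr1 (@^~ (size t))).
rewrite !xP ?size_rcons // !nth_rcons ltnn eqxx => /einj.
by [].
Qed.

Definition H' : dihypergraph (nat -> nat) :=
  Dihypergraph H'_edges_nonconstant.

(* A cardinal is represented by any type of that cardinality, so the least
   cardinal satisfying P is determined only up to equipotence. *)
Definition is_least_cardinal (P : Type -> Prop) (K : Type) : Prop :=
  P K /\ forall L : Type, P L -> [set: K] #<= [set: L].

Definition colorable (X : Type) (H : dihypergraph X) (K : Type) : Prop :=
  exists c : X -> K, forall x, edges H x -> nonconstant (c \o x).

Definition is_chromatic_number (X : Type) (H : dihypergraph X) :
  Type -> Prop := is_least_cardinal (colorable H).

Definition dominating (F : set (nat -> nat)) : Prop :=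
  forall c : nat -> nat,
    exists2 d, F d & finite_set [set n | ~ (c n <= d n)%N].

Definition is_dominating_number : Type -> Prop :=
  is_least_cardinal (fun K => exists2 F, dominating F & F #= [set: K]).

(* Main.v *)
(* A set of functions contains no edge of [H'] exactly when its tree of finite
   prefixes is finitely branching, that is, when it is bounded pointwise by a
   single function. Bounds of the color classes of a coloring therefore form a
   dominating family. Conversely, if [b] is eventually below [d] in a dominating
   family [F], then [b <= max d k] everywhere for some [k], and the choice of
   [(d, k)] is a coloring by [F * nat], which is equipotent to [F] since [F] is
   infinite. *)
Require Import Defs.
From mathcomp Require Import all_boot.
From mathcomp Require Import boolp classical_sets functions cardinality.

Set Implicit Arguments.
Unset Strict Implicit.
Unset Printing Implicit Defensive.

Local Open Scope classical_set_scope.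
Local Open Scope card_scope.

(** * Cardinal comparisons *)

Lemma finite_set_nat_bounded (A : set nat) :
  finite_set A -> exists m, forall n, A n -> (n <= m)%N.
Proof.
move=> /finite_seqP[s ->]; exists (\max_(n <- s) n) => n /= ns.
exact: (@leq_bigmax_seq _ s xpredT id).
Qed.

Lemma infinite_set_sequence (T : Type) (A : set T) :
  infinite_set A -> exists2 s : nat -> T, injective s & forall n, A (s n).
Proof.
elim/Ppointed: T => T in A *; first by rewrite emptyE => -[].
move=> /infiniteP/pcard_leP[f]; exists f => [i j fij|n].
  by apply: (@inj _ _ _ f) => //; rewrite inE.
exact: (@funS _ _ _ _ f).
Qed.

Lemma countable_sub_range (T : Type) (A : set T) (t : T) :
  countable A -> exists e : nat -> T, A `<=` range e.
Proof.
elim/Ppointed: T => T in A t *; first by case: (no t).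
by move=> /pcard_geP[f]; exists f; exact: surj.
Qed.

Lemma card_le_injective (T U : Type) :
  [set: T] #<= [set: U] -> exists f : T -> U, injective f.
Proof.
move=> TU; have [[u]|noU] := pselect (inhabited U); last first.
  have noT (t : T) : False.
    have := card_leP TU => -[f].
    by apply: noU; exists; case: (f (exist _ t (mem_setT t))).
  by exists (fun t => False_rect U (noT t)) => t; case: (noT t).
have /card_leP[f] := TU.
exists (fun t => val (f (exist _ t (mem_setT t)))) => t t' /val_inj ftt'.
have : exist _ t (mem_setT t) = exist _ t' (mem_setT t') :> [set: T].
  by apply: (@inj _ _ _ f) => //; rewrite inE.
by move=> [].
Qed.

(* A maximal set [S] of pairwise disjoint selectors must exhaust some [A i],
   which then embeds into [S], hence into every [A j]. *)
Lemma card_le_min (I T : Type) (A : I -> set T) (i0 : I) :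
  exists i, forall j, A i #<= A j.
Proof.
pose P (S : set (I -> T)) :=
  (forall s, S s -> forall i, A i (s i)) /\
  (forall s s' i, S s -> S s' -> s i = s' i -> s = s').
have [F FP Ftot|S [[SA Sinj] Smax]] := @Zorn_bigcup _ P.
  split=> [s [X FX Xs]|s s' i [X FX Xs] [Y FY Ys']].
    exact: (FP _ FX).1.
  by have [XY|YX] := Ftot _ _ FX FY; [apply: (FP _ FY).2; first exact: XY
    | apply: (FP _ FX).2 => //; exact: YX].
suff [i Ai] : exists i, A i `<=` (@^~ i) @` S.
  exists i => j; apply: card_le_trans (subset_card_le Ai) _.
  apply: card_le_trans (card_image_le _ _) _.
  have Sj : (@^~ j) @` S #= S.
    apply: inj_card_eq => s s'; rewrite !inE => Ss Ss'; exact: Sinj.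
  have /card_eqPle[_ SjS] := Sj; apply: card_le_trans SjS _.
  by apply: subset_card_le => _ [s Ss <-]; exact: SA.
apply: contrapT => /forallNP noi.
have /choice[s sP] : forall i, exists t, A i t /\ forall r, S r -> r i <> t.
  move=> i; have /existsNP[t /not_implyP[At tS]] := noi i.
  by exists t; split => // r Sr rt; apply: tS; exists r.
apply: (Smax (s |` S)).
  split; first exact: subsetUr.
  move=> /(_ s (or_introl erefl)) Ss.
  exact: (sP i0).2 Ss erefl.
split=> [r [->|/SA//] i|r r' i [->|Sr] [->|Sr'] //]; first exact: (sP i).1.
- by move=> /esym /((sP i).2 _ Sr').
- by move=> /((sP i).2 _ Sr).
- exact: Sinj.
Qed.

(* A maximal set [S] of disjoint injective sequences in [A] misses only a
   finite, hence countable, part of [A], so [A] is a quotient of [S * nat]. *)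
Lemma card_le_setX_nat (T : Type) (A : set T) :
  infinite_set A -> A `*` [set: nat] #<= A.
Proof.
move=> Ainf.
pose P (S : set (nat -> T)) :=
  (forall s, S s -> injective s /\ forall i, A (s i)) /\
  (forall s s' i j, S s -> S s' -> s i = s' j -> s = s').
have [F FP Ftot|S [[SA Sdis] Smax]] := @Zorn_bigcup _ P.
  split=> [s [X FX Xs]|s s' i j [X FX Xs] [Y FY Ys']].
    exact: (FP _ FX).1.
  by have [XY|YX] := Ftot _ _ FX FY; [apply: (FP _ FY).2; first exact: XY
    | apply: (FP _ FX).2 => //; exact: YX].
pose R := [set t | exists2 s, S s & exists i, s i = t].
have Rfin : finite_set (A `\` R).
  apply: contrapT => /infinite_set_sequence[s sinj sP].
  apply: (Smax (s |` S)).
    split; first exact: subsetUr.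
    move=> /(_ s (or_introl erefl)) Ss.
    by apply: (sP 0).2; exists s => //; exists 0.
  split=> [r [->|/SA//]|r r' i j [->|Sr] [->|Sr'] //].
  - by split=> // i; exact: (sP i).1.
  - by move=> e; case: (sP i) => _ []; exists r' => //; exists j.
  - by move=> e; case: (sP j) => _ []; exists r => //; exists i.
  - exact: Sdis.
(* With [S] empty, [A] would be its own finite remainder. The sequence [s0] will carry the codes of
   the remainder. *)
have [s0 Ss0] : S !=set0.
  apply: contrapT => /set0P/negP/negPn/eqP S0; apply: Ainf.
  apply: sub_finite_set Rfin => a Aa; split=> // -[s].
  by rewrite S0.
have [e eP] := countable_sub_range (s0 0) (finite_set_countable Rfin).
(* The number [p.2] codes a source, either an entry of [p.1] or one of the sequence [e] covering the
   remainder, together with the second coordinate of the pair. The [None] value is arbitrary. *)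
pose h (p : (nat -> T) * nat) : T * nat :=
  match unpickle p.2 : option ((nat + nat) * nat) with
  | Some (inl i, n) => (p.1 i, n)
  | Some (inr i, n) => (e i, n)
  | None => (p.1 0, 0)
  end.
have AS : A `*` [set: nat] `<=` h @` (S `*` [set: nat]).
  move=> [a n] [/= Aa _]; have [[s Ss [i <-]]|Ra] := pselect (R a).
    exists (s, pickle ((inl i, n) : (nat + nat) * nat)) => //.
    by rewrite /h pickleK.
  have [i _ <-] := eP a (conj Aa Ra).
  exists (s0, pickle ((inr i, n) : (nat + nat) * nat)) => //.
  by rewrite /h pickleK.
apply: card_le_trans (subset_card_le AS) _.
apply: card_le_trans (card_image_le _ _) _.
(* Evaluation is injective on [S * nat], as the sequences in [S] are injective with disjoint
   ranges. *)
pose g (p : (nat -> T) * nat) := p.1 p.2.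
have gS : g @` (S `*` [set: nat]) #= S `*` [set: nat].
  apply: inj_card_eq => -[s i] [s' j]; rewrite !inE /g => -[/= Ss _] [/= Ss' _].
  move=> sij; have ss' := Sdis _ _ _ _ Ss Ss' sij.
  by move: sij; rewrite -ss' => /(SA _ Ss).1 ->.
have /card_eqPle[_ Sg] := gS; apply: card_le_trans Sg _.
by apply: subset_card_le => _ [[s i] [/= Ss _] <-]; exact: (SA _ Ss).2.
Qed.

(** * Cylinders and edge-free sets *)

Lemma cylinder_rcons (t : seq nat) (k : nat) (b : nat -> nat) :
  cylinder (rcons t k) b <-> cylinder t b /\ b (size t) = k.
Proof.
split=> [bP|[bt bk] i].
  split=> [i it|]; first by rewrite bP ?size_rcons 1?ltnW// nth_rcons it.
  by rewrite bP ?size_rcons// nth_rcons ltnn eqxx.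
rewrite size_rcons ltnS leq_eqVlt nth_rcons => /predU1P[->|it].
  by rewrite ltnn eqxx.
by rewrite it bt.
Qed.

Lemma cylinder_mkseq (b : nat -> nat) (n : nat) : cylinder (mkseq b n) b.
Proof. by move=> i; rewrite size_mkseq => ?; rewrite nth_mkseq. Qed.

Section EdgeFree.
Variable C : set (nat -> nat).
Hypothesis C_edge_free : forall x, H'_edges x -> ~ forall n, C (x n).

(** Infinitely many successors of [t] could be listed by an injective [e]; members of [C] through
    each [rcons t (e n)] would then form an edge inside [C]. *)
Lemma edge_free_finite_branching (t : seq nat) :
  finite_set [set k | exists2 b, C b & cylinder (rcons t k) b].
Proof.
apply: contrapT => /infinite_set_sequence[e einj /(_ _)/cid2 eP].
apply: (@C_edge_free (fun n => projT1 (eP n))) => [|n].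
  by exists (e, t) => //= n; case: (eP n).
by case: (eP n).
Qed.

(** Each of the finitely many prefixes of length [n] has only finitely many one-entry extensions
    realized in [C]. *)
Lemma edge_free_finite_prefixes (n : nat) :
  finite_set ((fun b => mkseq b n) @` C).
Proof.
elim: n => [|n IH].
  by apply: sub_finite_set (finite_set1 [::]) => _ [b _ <-].
pose B t := rcons t @` [set k | exists2 b, C b & cylinder (rcons t k) b].
have BC t : finite_set (B t).
  exact: finite_image (edge_free_finite_branching t).
apply: sub_finite_set (bigcup_finite IH (fun t _ => BC t)) => _ [b Cb <-].
exists (mkseq b n); first by exists b.
exists (b n); last by rewrite -mkseqS.
by exists b => //; rewrite -mkseqS; exact: cylinder_mkseq.
Qed.

Lemma edge_free_bounded :
  exists d : nat -> nat, forall b, C b -> forall n, (b n <= d n)%N.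
Proof.
suff /choice[d dP] : forall n, exists m, forall b, C b -> (b n <= m)%N.
  by exists d => b Cb n; exact: dP.
(* The value at [n] is read off the prefix of length [n.+1]. *)
move=> n; have [m mP] := finite_set_nat_bounded
  (finite_image (nth 0 ^~ n) (edge_free_finite_prefixes n.+1)).
exists m => b Cb; apply: mP; exists (mkseq b n.+1); first by exists b.
by rewrite nth_mkseq.
Qed.

End EdgeFree.

(** * Colorings and dominating families *)

Lemma colorable_dominating (L : Type) :
  colorable H' L -> exists2 F, dominating F & F #<= [set: L].
Proof.
move=> [c cP].
(* A color class is edge-free, since an edge inside it would be monochromatic. *)
have /choice[d dP] : forall l, exists d : nat -> nat,
    forall b, c b = l -> forall n, (b n <= d n)%N.
  move=> l; apply: (@edge_free_bounded [set b | c b = l]) => x /cP[i [j cij]] xl.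
  by apply: cij; rewrite /= !xl.
exists (range d); last exact: card_image_le.
move=> b; exists (d (c b)); first by exists (c b).
by apply: sub_finite_set (finite_set0 _) => n; case; exact: dP.
Qed.

Lemma dominating_infinite (F : set (nat -> nat)) :
  dominating F -> infinite_set F.
Proof.
move=> Fdom /finite_seqP[s sF].
(* The successor of the pointwise maximum exceeds every member of [s] at every argument. *)
have [d] := Fdom (fun n => (\max_(d <- s) d n).+1).
rewrite sF /= => ds; apply/contra_not: infinite_nat.
apply: sub_finite_set => n _ /=; apply/negP; rewrite -ltnNge ltnS.
exact: (@leq_bigmax_seq _ s xpredT (fun d => d n)).
Qed.

(* The color [(d, k)] stands for the set of [b] bounded by [max d k]; these
   sets are finitely branching, unlike the sets of [b] eventually below [d]. *)
Lemma dominating_colorable (F : set (nat -> nat)) :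
  dominating F -> colorable H' (F `*` [set: nat]).
Proof.
move=> Fdom.
have /choice[c cP] : forall b, exists p : F `*` [set: nat],
    forall n, (b n <= maxn ((val p).1 n) (val p).2)%N.
  (* Here [k] bounds [b] on the finitely many arguments where [b] exceeds [d]. *)
  move=> b; have [d Fd /(finite_image b)/finite_set_nat_bounded[k kP]] := Fdom b.
  have dk : (d, k) \in F `*` [set: nat] by rewrite inE.
  exists (exist _ (d, k) dk) => n /=; rewrite leq_max.
  by have [//|bd] := boolP (b n <= d n)%N; apply: kP; exists n => //; exact/negP.
exists c => x [[e t] /= einj xP]; apply: contrapT => cconst.
have cx n : c (x n) = c (x 0).
  by apply: contrapT => cn; apply: cconst; exists n, 0.
(* On a monochromatic edge, [m] bounds every value [x n (size t) = e n], which is impossible for an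
   injective [e]. *)
pose p := val (c (x 0)); pose m := maxn (p.1 (size t)) p.2.
apply: infinite_nat.
have em : e @` [set: nat] `<=` `I_m.+1.
  move=> _ [n _ <-]; have /cylinder_rcons[_ <-] := xP n.
  by rewrite /= ltnS; have := cP (x n) (size t); rewrite cx.
have /card_eqPle[_ Ne] : e @` [set: nat] #= [set: nat].
  by apply: inj_card_eq => i j _ _; exact: einj.
exact: card_le_finite Ne (sub_finite_set em (finite_II _)).
Qed.

Lemma colorable_card_le (X : Type) (H : dihypergraph X) (K L : Type) :
  [set: K] #<= [set: L] -> colorable H K -> colorable H L.
Proof.
move=> /card_le_injective[f finj] [c cP].
by exists (f \o c) => x /cP[i [j cij]]; exists i, j => /= /finj.
Qed.

Theorem proposition6p1 :
  exists K : Type, is_chromatic_number H' K /\ is_dominating_number K.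
Proof.
(* Taking a minimum by [card_le_min] requires at least one dominating family. *)
have domT : dominating [set: nat -> nat].
  move=> c; exists c => //; apply: sub_finite_set (finite_set0 _) => n.
  by case.
have [[F Fdom] Fmin] := @card_le_min {F | dominating F} _ sval (exist _ _ domT).
have {}Fmin G : dominating G -> F #<= G by move=> Gd; exact: (Fmin (exist _ G Gd)).
exists F; split; split.
(* The coloring takes values in [F * nat], which embeds into the infinite set [F]. *)
- apply: colorable_card_le (dominating_colorable Fdom).
  have := card_le_setX_nat (dominating_infinite Fdom).
  by rewrite (card_le_eql (card_setT _)) (card_le_eqr (card_setT _)).
- move=> L /colorable_dominating[G /Fmin FG GL].
  by rewrite (card_le_eql (card_setT _)); exact: card_le_trans GL.
- by exists F => //; rewrite card_eq_sym.
- move=> L [G /Fmin FG /card_eqPle[GL _]].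
  by rewrite (card_le_eql (card_setT _)); exact: card_le_trans GL.
Qed.
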